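(* Let $d\ge 2$ and let $h\colon L^\infty(\mathbb S_{d-1})\to\mathbb R$ be bounded (maps bounded sets to bounded sets) with $h(g\circ\psi)=h(g)$ for all $g\in L^\infty(\mathbb S_{d-1})$ and every bijection $\psi\colon\mathbb S_{d-1}\to\mathbb S_{d-1}$. Let $\mu_0,\nu_0\in\mathcal P_c^*(\mathbb R^d)$ satisfy $\mathcal N_h[\mu_0]\neq\mathcal N_h[\nu_0]$ and consider $$\mathbb F=\{(\mathbf A\cdot+\mathbf y)_\#\mu_0 : \mathbf A\in\mathrm{GL}(d),\ \mathbf y\in\mathbb R^d\},\qquad \mathbb G=\{(\mathbf A\cdot+\mathbf y)_\#\nu_0 : \mathbf A\in\mathrm{GL}(d),\ \mathbf y\in\mathbb R^d\}.$$ Then $\mathbb F\subset\mathcal P_c^*(\mathbb R^d)$ and $\mathbb G\subset\mathcal P_c^*(\mathbb R^d)$, and $\mathcal N_h[\mathbb F]$ and $\mathcal N_h[\mathbb G]$ are linearly separable in $L^\infty_\rho(\mathbb R)$.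
   Context: Let $\mathbb S_{d-1}=\{x\in\mathbb R^d:\|x\|=1\}$. For $\theta\in\mathbb S_{d-1}$ and a finite Borel measure $\mu$ on $\mathbb R^d$ let $\mathcal R_\theta[\mu]=(\langle\cdot,\theta\rangle)_\#\mu$. Fix a reference Borel probability measure $\rho$ on $\mathbb R$ without atoms. For a probability measure $\nu$ on $\mathbb R$ with $F_\nu(t)=\nu((-\infty,t])$, let $F_\nu^{[-1]}(t)=\inf\{s:F_\nu(s)>t\}$ and the CDT $\hat\nu=F_\nu^{[-1]}\circ F_\rho$; $\widehat{\mathcal R}_\theta[\mu]$ is the CDT of $\mathcal R_\theta[\mu]$. For $g\in L^2_\rho(\mathbb R)$, $\operatorname{mean}(g)=\int g\,\mathrm d\rho$, $\operatorname{std}(g)=(\int |g-\operatorname{mean}(g)|^2\mathrm d\rho)^{1/2}$. $\mathcal P_c^*(\mathbb R^d)$ is the set of compactly supported Borel probability measures on $\mathbb R^d$ whose support has affine hull of dimension $>d-1$ (not contained in a hyperplane). For $\mu\in\mathcal P_c^*(\mathbb R^d)$: $\mathcal N[\mu](t,\theta)=\big(\widehat{\mathcal R}_\theta[\mu](t)-\operatorname{mean}(\widehat{\mathcal R}_\theta[\mu])\big)/\operatorname{std}(\widehat{\mathcal R}_\theta[\mu])$ and $\mathcal N_h[\mu](t)=h(\mathcal N[\mu](t,\cdot))$. Subsets $A,B$ of a normed space $V$ are linearly separable if there exist a continuous linear functional $\ell$ on $V$ and $c\in\mathbb R$ with $\ell>c$ on $A$ and $\ell<c$ on $B$.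
   Formalization: It is additionally assumed that N_h[μ0] and N_h[ν0] are Borel measurable functions of t (for arbitrary bounded invariant h they need not lie in L^∞_ρ), and h is taken as a function of pointwise functions on the sphere rather than of a.e. classes. *)

(* Defs.v *)
From HB Require Import structures.
From mathcomp Require Import all_boot all_order all_algebra.
From mathcomp Require Import all_classical all_reals all_analysis.
Set Implicit Arguments.
Unset Strict Implicit.
Unset Printing Implicit Defensive.
Import Order.TTheory GRing.Theory Num.Theory.
Import numFieldNormedType.Exports.
Local Open Scope classical_set_scope.
Local Open Scope ring_scope.

Definition Rd (R : realType) (d : nat) := g_sigma_algebraType (@open 'rV[R]_d).

Definition dotv (R : realType) (d : nat) (x y : 'rV[R]_d) : R :=
  \sum_(i < d) x ord0 i * y ord0 i.

Definition sphere (R : realType) (d : nat) := {x : 'rV[R]_d | dotv x x == 1}.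

Definition msupp (R : realType) (d : nat) (m : set (Rd R d) -> \bar R)
  : set 'rV[R]_d :=
  [set x | forall U : set 'rV[R]_d, open U -> U x -> (0 < m U)%E].

Definition Pcstar (R : realType) (d : nat) (m : set (Rd R d) -> \bar R) : Prop :=
  [/\ exists P : probability (Rd R d) R, (P : set (Rd R d) -> \bar R) = m,
      compact (msupp m)
    & ~ exists (a : 'rV[R]_d) (c : R),
          a != 0 /\ msupp m `<=` [set x | dotv x a = c]].

Definition radon (R : realType) (d : nat) (m : set (Rd R d) -> \bar R)
  (th : sphere R d) : set R -> \bar R :=
  pushforward m (fun x : Rd R d => dotv x (val th)).

Definition cdf (R : realType) (nu : set R -> \bar R) (t : R) : R :=
  fine (nu [set s | s <= t]).

Definition ginv (R : realType) (F : R -> R) (t : R) : R :=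
  inf [set s | t < F s].

Definition cdt (R : realType) (rho : probability R R) (nu : set R -> \bar R)
  : R -> R := fun t => ginv (cdf nu) (cdf rho t).

Definition rmean (R : realType) (rho : probability R R) (g : R -> R) : R :=
  (\int[rho]_x g x)%R.

Definition rstd (R : realType) (rho : probability R R) (g : R -> R) : R :=
  Num.sqrt (\int[rho]_x (g x - rmean rho g) ^+ 2)%R.

Definition NRCDT (R : realType) (d : nat) (rho : probability R R)
  (m : set (Rd R d) -> \bar R) (t : R) (th : sphere R d) : R :=
  let g := cdt rho (radon m th) in (g t - rmean rho g) / rstd rho g.

Definition Nh (R : realType) (d : nat) (rho : probability R R)
  (h : (sphere R d -> R) -> R) (m : set (Rd R d) -> \bar R) : R -> R :=
  fun t => h (NRCDT rho m t).

Definition no_atoms (R : realType) (rho : probability R R) : Prop :=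
  forall x : R, rho [set x] = 0%E.

Definition h_bounded (R : realType) (d : nat) (h : (sphere R d -> R) -> R) : Prop :=
  forall M : R, exists C : R, forall g : sphere R d -> R,
    (forall th, `|g th| <= M) -> `|h g| <= C.

Definition h_invariant (R : realType) (d : nat) (h : (sphere R d -> R) -> R) : Prop :=
  forall (g : sphere R d -> R) (psi : sphere R d -> sphere R d),
    (exists M : R, forall th, `|g th| <= M) ->
    bijective psi -> h (g \o psi) = h g.

Definition affine_orbit (R : realType) (d : nat) (m : set (Rd R d) -> \bar R)
  : set (set (Rd R d) -> \bar R) :=
  [set m' | exists (A : 'M[R]_d) (y : 'rV[R]_d),
     A \in unitmx /\ m' = pushforward m (fun x : Rd R d => (x *m A + y : Rd R d))].

Definition Linf (R : realType) (rho : probability R R) (f : R -> R) : Prop :=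
  measurable_fun setT f /\ exists M : R, {ae rho, forall t, `|f t| <= M}.

(* l is (a representative of) a continuous linear functional on
   L^infty_rho(R): linear on L^infty functions and bounded w.r.t. the
   essential sup norm (hence also constant on rho-a.e. classes). *)
Definition cont_lin_functional (R : realType) (rho : probability R R)
  (l : (R -> R) -> R) : Prop :=
  [/\ forall f g, Linf rho f -> Linf rho g -> l (f \+ g) = l f + l g,
      forall (a : R) f, Linf rho f -> l (fun t => a * f t) = a * l f
    & exists C : R, forall f (M : R), Linf rho f ->
        {ae rho, forall t, `|f t| <= M} -> `|l f| <= C * M].

Definition lin_separable (R : realType) (rho : probability R R)
  (A B : set (R -> R)) : Prop :=
  exists (l : (R -> R) -> R) (c : R), cont_lin_functional rho l /\
    (forall f, A f -> c < l f) /\ (forall g, B g -> l g < c).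

(* Main.v *)
(** A direction theta sees the image of mu under x |-> xA + y as a rescaled and
    translated copy of what the direction theta A^T / |theta A^T| sees of mu.
    The CDT commutes with increasing affine maps of the line, so subtracting
    the mean and dividing by the standard deviation removes scale and shift:
    N[mu'](t, .) = N[mu](t, .) o psi for a bijection psi of the sphere, whenever
    F_rho(t) < 1, that is for rho-almost every t. Hence N_h is a.e. constant on
    each orbit, and with k = N_h[mu0] - N_h[nu0] the functional f |-> \int f k
    separates the two classes.

    Boundedness of N needs a lower bound on the standard deviations that is
    uniform in theta: by compactness of the sphere, some e > 0 is such that
    every one-dimensional projection of mu puts mass at least e on each of two
    half-lines at distance at least e. *)
Require Import Defs.
From HB Require Import structures.
From mathcomp Require Import all_boot all_order all_algebra.
From mathcomp Require Import all_classical all_reals all_analysis.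
From mathcomp Require Import measurable_realfun lra ring.
Import Order.TTheory GRing.Theory Num.Theory.
Import numFieldNormedType.Exports.
Local Open Scope classical_set_scope.
Local Open Scope ring_scope.

Set Implicit Arguments.
Unset Strict Implicit.

(** * Distribution functions on the line *)

Section CdfOnLine.
Variables (R : realType) (nu : probability R R).
Implicit Types s t : R.

Lemma measurable_le t : measurable [set s : R | s <= t].
Proof. by rewrite -[X in measurable X]set_itvNyc. Qed.

Lemma measurable_gt t : measurable [set s : R | t < s].
Proof. by rewrite -[X in measurable X]set_itvoy. Qed.

Lemma cdfE t : (Defs.cdf nu t)%:E = nu [set s | s <= t].
Proof. by rewrite /Defs.cdf fineK// fin_num_measure//; exact: measurable_le. Qed.

Lemma cdf_le1 t : Defs.cdf nu t <= 1.
Proof. by rewrite -lee_fin cdfE probability_le1//; exact: measurable_le. Qed.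

Lemma cdf_ge0 t : 0 <= Defs.cdf nu t.
Proof. by rewrite -lee_fin cdfE. Qed.

Lemma cdf_homo : {homo Defs.cdf nu : s t / s <= t}.
Proof.
move=> s t st; rewrite -lee_fin !cdfE le_measure ?inE//; try exact: measurable_le.
by move=> x /= /le_trans; apply.
Qed.

Lemma cdf_measurable : measurable_fun setT (Defs.cdf nu).
Proof. exact: nondecreasing_measurable cdf_homo. Qed.

Lemma prob_gtE t : nu [set s | t < s] = (1 - Defs.cdf nu t)%:E.
Proof.
have -> : [set s | t < s] = ~` [set s | s <= t].
  by apply/seteqP; split => s /=; rewrite ltNge => /negP.
by rewrite probability_setC ?EFinB ?cdfE//; exact: measurable_le.
Qed.

Lemma prob_itv_ocE s t : s <= t ->
  nu `]s, t]%classic = (Defs.cdf nu t - Defs.cdf nu s)%:E.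
Proof.
move=> st; rewrite EFinB !cdfE.
have -> : `]s, t]%classic = [set x | x <= t] `\` [set x | x <= s].
  apply/seteqP; split => x /=; rewrite in_itv/=.
    by move=> /andP[sx xt]; split => //; apply/negP; rewrite -ltNge.
  by move=> [-> /negP]; rewrite -ltNge => ->.
rewrite measureD; try exact: measurable_le.
  rewrite (_ : _ `&` _ = [set x | x <= s])//; apply/seteqP; split => x /=.
    by case.
  by move=> xs; split => //; exact: le_trans st.
by rewrite -ge0_fin_numE// fin_num_measure//; exact: measurable_le.
Qed.

Lemma cdf_cvgy : Defs.cdf nu t @[t --> +oo%R] --> (1 : R).
Proof.
have mid : measurable_fun setT (id : R -> R) := @measurable_id _ _ _.
have := cvg_cdfy1 (mfun_Sub (mem_set mid) : {RV nu >-> R}).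
move/fine_cvgP => [_]; apply: cvg_trans; apply: near_eq_cvg; near=> t.
by rewrite /= /Defs.cdf /random_variable.cdf /distribution /pushforward set_itvNyc.
Unshelve. all: by end_near. Qed.

Lemma cdf_cvgNy : Defs.cdf nu t @[t --> -oo%R] --> (0 : R).
Proof.
have mid : measurable_fun setT (id : R -> R) := @measurable_id _ _ _.
have := cvg_cdfNy0 (mfun_Sub (mem_set mid) : {RV nu >-> R}).
move/fine_cvgP => [_]; apply: cvg_trans; apply: near_eq_cvg; near=> t.
by rewrite /= /Defs.cdf /random_variable.cdf /distribution /pushforward set_itvNyc.
Unshelve. all: by end_near. Qed.

Hypothesis nu_atomless : no_atoms nu.

(** The half-open intervals [G n] shrink to [x], so by continuity from above their masses tend to
    the mass of the atom [x], which is zero. One interval of mass below [e] then controls all nearby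
    values, by monotonicity. *)
Lemma atomless_cdf_continuous : continuous (Defs.cdf nu).
Proof.
move=> /= x; apply/cvgrPdist_lt => e e0.
pose G n := `]x - n.+1%:R^-1, x + n.+1%:R^-1]%classic.
have GE : \bigcap_n G n = [set x].
  apply/seteqP; split => [y Gy|y -> n _] /=; last first.
    by rewrite /G/= in_itv/= ltrBlDr ltrDl invr_gt0 ltr0n/= lerDl invr_ge0 ler0n.
  apply/eqP; rewrite eq_sym -subr_eq0 -normr_le0; apply/ler_addgt0Pl => z z0.
  rewrite addr0; have [n nz] := ltr_add_invr z0; rewrite add0r in nz.
  have := Gy n I; rewrite /G/= in_itv/= => /andP[h1 h2].
  apply: le_trans (ltW nz); move: h1 h2; set c := _^-1 => h1 h2.
  by rewrite ler_norml; apply/andP; split; lra.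
have cG : nu (G n) @[n --> \oo] --> nu (\bigcap_n G n).
  apply: nonincreasing_cvg_mu => //.
  - by rewrite -ge0_fin_numE// fin_num_measure//; exact: measurable_itv.
  - by move=> n; exact: measurable_itv.
  - by rewrite GE; exact: measurable_set1.
  - move=> n m nm; apply/subsetPset; apply: subset_itv; rewrite bnd_simp.
      by rewrite lerD2l lerN2 lef_pV2 ?posrE// ler_nat.
    by rewrite lerD2l lef_pV2 ?posrE// ler_nat.
rewrite GE nu_atomless in cG.
have /fine_cvgP[_ /cvgrPdist_lt/(_ _ e0)[N _ /(_ N (leqnn N))/=]] := cG.
have N0 : 0 < N.+1%:R^-1 :> R by rewrite invr_gt0 ltr0n.
have cc : x - N.+1%:R^-1 <= x + N.+1%:R^-1.
  by rewrite lerD2l (le_trans _ (ltW N0))// oppr_le0 ltW.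
rewrite /G (prob_itv_ocE cc)/= sub0r normrN => /(le_lt_trans (ler_norm _)).
clear cG GE; move: N0 cc; move: (N.+1%:R^-1 : R) => c c0 _ FN.
near=> y.
have : `|x - y| < c by near: y; exact: cvgr_dist_lt.
rewrite ltr_norml => /andP[y1 y2].
have h1 : Defs.cdf nu (x - c) <= Defs.cdf nu y by apply: cdf_homo; lra.
have h2 : Defs.cdf nu y <= Defs.cdf nu (x + c) by apply: cdf_homo; lra.
have h3 : Defs.cdf nu (x - c) <= Defs.cdf nu x by apply: cdf_homo; lra.
have h4 : Defs.cdf nu x <= Defs.cdf nu (x + c) by apply: cdf_homo; lra.
by rewrite ltr_norml; apply/andP; split; lra.
Unshelve. all: by end_near. Qed.

Lemma atomless_cdf_surj (v : R) : 0 < v < 1 -> exists t, Defs.cdf nu t = v.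
Proof.
move=> /andP[v0 v1].
have [a av] : exists a, Defs.cdf nu a < v.
  have /(_ _) := cvgr_lt _ cdf_cvgNy _ v0.
  by move=> /filter_ex[a av]; exists a.
have [b bv] : exists b, v < Defs.cdf nu b.
  have /(_ _) := cvgr_gt _ cdf_cvgy _ v1.
  by move=> /filter_ex[b bv]; exists b.
have ab : a <= b.
  by rewrite leNgt; apply/negP => /ltW/cdf_homo; rewrite leNgt (lt_trans av bv).
have [||c _ <-] := @IVT R (Defs.cdf nu) a b v ab; last by exists c.
- exact/continuous_subspaceT/atomless_cdf_continuous.
- by rewrite ge_min le_max (ltW av) (ltW bv) orbT.
Qed.

(** The set [S] where the distribution function equals 1 is bounded below, and continuity puts
    [inf S] into [S]. Hence [S] is covered by the point [inf S], which is no atom, and the open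
    half-line above it, whose mass is [1 - 1]. *)
Lemma atomless_ae_cdf_lt1 : {ae nu, forall t, Defs.cdf nu t < 1}.
Proof.
pose S := [set t | Defs.cdf nu t = 1].
have SE : ~` [set t | Defs.cdf nu t < 1] = S.
  apply/seteqP; split => t /= => [/negP|->]; last by rewrite ltxx.
  by rewrite -leNgt => h; apply/eqP; rewrite eq_le cdf_le1.
have mS : measurable S.
  have := @cdf_measurable measurableT _ (measurable_set1 (1:R)).
  by rewrite setTI.
exists S; split => //; last by rewrite -SE.
have [->|/set0P S0] := eqVneq S set0; first by rewrite measure0.
have [t0 t0E] : exists t, Defs.cdf nu t = 2^-1.
  by apply: atomless_cdf_surj; lra.
have Slb : has_lbound S.
  exists t0 => t /= St; rewrite leNgt; apply/negP => /ltW/cdf_homo.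
  by rewrite St t0E; lra.
have ST : S (inf S).
  apply/eqP; rewrite eq_le cdf_le1 /= leNgt; apply/negP => lt1.
  have /(_ _)/nbhs_ballP := cvgr_lt _ (@atomless_cdf_continuous (inf S)) _ lt1.
  move=> [e /= e0 eS].
  have [s Ss sT] := inf_adherent e0 (conj S0 Slb).
  have Ts := ge_inf Slb Ss.
  suff /eS : ball (inf S) e s by rewrite /mkset Ss ltxx.
  by rewrite -ball_normE/= ltr_norml; apply/andP; split; lra.
apply/eqP; rewrite -measure_le0.
have sub : S `<=` [set inf S] `|` [set s | inf S < s].
  move=> t St; have := ge_inf Slb St; rewrite le_eqVlt => /orP[/eqP <-|]; first by left.
  by right.
apply: (le_trans (le_measure _ _ _ sub)); rewrite ?inE//.
  by apply: measurableU => //; exact: measurable_gt.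
apply: (le_trans (measureU2 _ _ _)) => //; first exact: measurable_gt.
rewrite [X in (X + _)%E](nu_atomless (inf S)) [X in (_ + X)%E](prob_gtE (inf S)).
by rewrite ST subrr adde0.
Qed.

End CdfOnLine.

(** * Generalized inverse of a function that rises from 0 to 1 within [[-B, B]] *)

Section GeneralizedInverse.
Variables (R : realType) (F : R -> R) (B : R).
Hypothesis F_lo : forall s : R, s < - B -> F s = 0.
Hypothesis F_hi : forall s, B <= s -> F s = 1.
Implicit Types v a b k : R.

Lemma ginv_has_inf v : 0 <= v < 1 -> has_inf [set s | v < F s].
Proof.
move=> /andP[v0 v1]; split; first by exists B => /=; rewrite F_hi.
exists (- B) => s /= vs; rewrite leNgt; apply/negP => /F_lo s0.
by move: vs; rewrite s0 ltNge v0.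
Qed.

Lemma ginv_le v a : 0 <= v < 1 -> v < F a -> ginv F v <= a.
Proof. by move=> /ginv_has_inf[_ lb] va; exact: ge_inf. Qed.

Lemma ginv_ge v b : 0 <= v < 1 -> (forall s, s < b -> F s <= v) ->
  b <= ginv F v.
Proof.
move=> /ginv_has_inf[ne _] h; apply: lb_le_inf => // s /= vs.
by rewrite leNgt; apply/negP => /h; rewrite leNgt vs.
Qed.

Lemma ginv_homo v w : 0 <= v -> w < 1 -> v <= w -> ginv F v <= ginv F w.
Proof.
move=> v0 w1 vw; have vi : 0 <= v < 1 by rewrite v0 (le_lt_trans vw).
have wi : 0 <= w < 1 by rewrite (le_trans v0 vw).
have [ne _] := ginv_has_inf wi.
by apply: lb_le_inf => // s /= ws; exact: ginv_le vi (le_lt_trans vw ws).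
Qed.

Lemma ginv_itv v : 0 <= v < 1 -> - B <= ginv F v <= B.
Proof.
move=> vi; have /andP[v0 v1] := vi; apply/andP; split.
  by apply: ginv_ge => // s /F_lo ->.
by apply: ginv_le => //; rewrite F_hi.
Qed.

(** The increasing bijection [x |-> k * x + b] carries one of the two sets under [inf] onto the
    other. *)
Lemma ginv_affine v k b : 0 < k -> 0 <= v < 1 ->
  ginv (fun s => F ((s - b) / k)) v = k * ginv F v + b.
Proof.
move=> k0 vi; have [ne lb] := ginv_has_inf vi.
apply/eqP; rewrite eq_le; apply/andP; split.
  rewrite -lerBlDr -ler_pdivrMl//; apply: lb_le_inf => // s /= vs.
  rewrite ler_pdivrMl// lerBlDr; apply: ge_inf => /=.
    exists (k * ginv F v + b) => x /= vx.
    by rewrite -lerBrDr mulrC -ler_pdivlMr//; exact: ge_inf.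
  by rewrite addrK mulrC mulKf// gt_eqF.
apply: lb_le_inf => /=.
  by have [s vs] := ne; exists (k * s + b) => /=; rewrite addrK mulrC mulKf// gt_eqF.
by move=> x /= vx; rewrite -lerBrDr mulrC -ler_pdivlMr//; exact: ge_inf.
Qed.

End GeneralizedInverse.

(* Here [inf] is taken over the empty set, where it is [0] instead of [+oo]. *)
Lemma ginv_junk (R : realType) (F : R -> R) (v : R) :
  (forall s, F s <= 1) -> 1 <= v -> ginv F v = 0.
Proof.
move=> F1 v1; rewrite /ginv (_ : [set _ | _] = set0) ?inf0//.
by rewrite -subset0 => s /=; rewrite ltNge (le_trans (F1 s)).
Qed.

(** * The quantile function of [F] composed with the distribution function of [rho] *)

Section QuantileMap.
Variables (R : realType) (rho : probability R R) (F : R -> R) (B : R).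
Hypothesis F_lo : forall s : R, s < - B -> F s = 0.
Hypothesis F_hi : forall s, B <= s -> F s = 1.
Hypothesis F_le1 : forall s, F s <= 1.
Hypothesis B0 : 0 <= B.
Let g t := ginv F (Defs.cdf rho t).

Lemma quantile_norm_le t : `|g t| <= B.
Proof.
rewrite /g; have [t1|t1] := ltP (Defs.cdf rho t) 1; last first.
  by rewrite ginv_junk// normr0.
by rewrite ler_norml (ginv_itv F_lo F_hi)// cdf_ge0.
Qed.

(** Where [cdf rho t < 1] the map is nondecreasing, but the default value 0 beyond may break
    monotonicity. Putting the upper bound [B] there restores it, and [g] is recovered by a
    measurable case distinction. *)
Lemma quantile_measurable : measurable_fun setT g.
Proof.
pose g1 t := if Defs.cdf rho t < 1 then g t else B.
have mg1 : measurable_fun setT g1.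
  apply: nondecreasing_measurable => // s t st; rewrite /g1.
  have st' := cdf_homo rho st.
  case: (ltP (Defs.cdf rho t) 1) => t1.
    by rewrite (le_lt_trans st' t1) (ginv_homo F_lo F_hi)// cdf_ge0.
  by case: ifP => // _; have := quantile_norm_le s; rewrite ler_norml => /andP[].
rewrite (_ : g = fun t => if Defs.cdf rho t < 1 then g1 t else 0).
  apply: measurable_fun_ifT => //.
  exact: measurable_fun_ltr (cdf_measurable rho) (measurable_cst _).
apply/funext => t; rewrite /g1; case: ltP => // t1.
by rewrite /g ginv_junk.
Qed.

End QuantileMap.

(** * Integrals of bounded functions against a probability *)

Section BoundedIntegrals.
Variables (R : realType) (rho : probability R R).

Lemma bounded_integrable (f : R -> R) (M : R) : measurable_fun setT f ->
  (forall x, `|f x| <= M) -> rho.-integrable setT (EFin \o f).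
Proof.
move=> mf fM; apply: measurable_bounded_integrable => //.
  by rewrite (le_lt_trans (probability_le1 _ _)) ?ltry.
by exists M; split; rewrite ?num_real// => x Mx y _; exact: le_trans (fM y) (ltW Mx).
Qed.

Lemma Rintegral_norm_le (f : R -> R) (M : R) : measurable_fun setT f ->
  (forall x, `|f x| <= M) -> `|(\int[rho]_x f x)%R| <= M.
Proof.
move=> mf fM; have fi := bounded_integrable mf fM.
apply: (le_trans (le_normr_Rintegral _ fi)) => //.
have -> : M = (\int[rho]_x M)%R.
  by rewrite Rintegral_cst// [X in fine X](probability_setT rho) mulr1.
apply: le_Rintegral => //.
  apply: (@bounded_integrable _ M); last by move=> x; rewrite normr_id.
  exact: measurableT_comp.
by apply: (@bounded_integrable _ `|M|).
Qed.

Lemma ae_eq_Rintegral (f g : R -> R) : measurable_fun setT f ->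
  measurable_fun setT g -> {ae rho, forall t, f t = g t} ->
  (\int[rho]_x f x = \int[rho]_x g x)%R.
Proof.
move=> mf mg fg; congr fine; apply: ae_eq_integral => //.
- exact/measurable_EFinP.
- exact/measurable_EFinP.
- by apply: filterS fg => t /= -> _.
Qed.

(** Markov's inequality: [c] times the indicator of [E] lies below [f]. *)
Lemma Rintegral_ge_mass (f : R -> R) (E : set R) (c : R) : measurable E ->
  rho.-integrable setT (EFin \o f) -> 0 <= c -> (forall t, 0 <= f t) ->
  (forall t, E t -> c <= f t) ->
  c * fine (rho E) <= (\int[rho]_x f x)%R.
Proof.
move=> mE fi c0 f0 cf.
have mI : measurable_fun setT (\1_E : R -> R) by exact: measurable_indic.
have iI : rho.-integrable setT (EFin \o (\1_E : R -> R)).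
  apply: (@bounded_integrable _ 1) => // x; rewrite indicE.
  by case: (_ \in _); rewrite ?normr0 ?normr1.
have -> : fine (rho E) = (\int[rho]_x (\1_E x))%R.
  by rewrite /Rintegral integral_indic// setIT.
rewrite -RintegralZl//; apply: le_Rintegral => //.
  apply: (@bounded_integrable _ c); first exact: measurable_funM.
  move=> x; rewrite indicE normrM (ger0_norm c0).
  by case: (_ \in _); rewrite ?normr0 ?normr1 ?mulr0 ?mulr1.
move=> x _; rewrite indicE; have [/set_mem/cf|_] := boolP (x \in E).
  by rewrite mulr1.
by rewrite mulr0.
Qed.

End BoundedIntegrals.

(** * Mean and standard deviation: bounds and behaviour under affine maps *)

Section MeanAndDeviation.
Variables (R : realType) (rho : probability R R).

Lemma rmean_norm_le (g : R -> R) (M : R) : measurable_fun setT g ->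
  (forall x, `|g x| <= M) -> `|rmean rho g| <= M.
Proof. exact: Rintegral_norm_le. Qed.

Lemma deviation_measurable (g : R -> R) (c : R) : measurable_fun setT g ->
  measurable_fun setT (fun x => (g x - c) ^+ 2).
Proof. by move=> mg; apply: measurable_funX; exact: measurable_funB. Qed.

Lemma deviation_integrable (g : R -> R) (M c : R) : measurable_fun setT g ->
  (forall x, `|g x| <= M) ->
  rho.-integrable setT (EFin \o (fun x => (g x - c) ^+ 2)).
Proof.
move=> mg gM; apply: (@bounded_integrable _ _ _ ((M + `|c|) ^+ 2)).
  exact: deviation_measurable.
move=> x; rewrite normrX lerXn2r// ?nnegrE ?addr_ge0//.
  exact: le_trans (gM x).
by rewrite (le_trans (ler_normB _ _))// lerD2r.
Qed.

(** Markov's inequality for the squared deviation, on whichever of [E1] and [E2] has its values away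
    from the mean. *)
Lemma rstd_ge (g : R -> R) (M a b c p : R) (E1 E2 : set R) :
  measurable_fun setT g -> (forall x, `|g x| <= M) ->
  measurable E1 -> measurable E2 -> (p%:E <= rho E1)%E -> (p%:E <= rho E2)%E ->
  0 <= c -> 2 * c <= b - a ->
  (forall t, E1 t -> g t <= a) -> (forall t, E2 t -> b <= g t) ->
  Num.sqrt (c ^+ 2 * p) <= rstd rho g.
Proof.
move=> mg gM mE1 mE2 pE1 pE2 c0 cab g1 g2; rewrite /rstd ler_wsqrtr//.
set m := rmean rho g.
suff [E [mE pE gE]] : exists E, [/\ measurable E, (p%:E <= rho E)%E &
    forall t, E t -> c <= `|g t - m|].
  have := @Rintegral_ge_mass _ rho (fun x => (g x - m) ^+ 2) E (c ^+ 2) mE.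
  move=> /(_ (deviation_integrable m mg gM) (sqr_ge0 _) (fun t => sqr_ge0 _)) h.
  apply: le_trans (h _) => [|t /gE]; last first.
    by move=> h1; rewrite -[leRHS]real_normK ?num_real// lerXn2r ?nnegrE.
  by rewrite ler_wpM2l ?sqr_ge0// -lee_fin fineK// fin_num_measure.
(* [m] is at distance at least [c] from [a] or from [b]. *)
have [mab|mab] := leP ((a + b) / 2) m.
  exists E1; split => // t /g1 ta; rewrite distrC (le_trans _ (ler_norm _))//; lra.
exists E2; split => // t /g2 tb; rewrite (le_trans _ (ler_norm _))//; lra.
Qed.

(** The affine relation is asked only almost everywhere, because the one between two CDTs can fail
    where [cdf rho] equals 1. *)
Lemma rmean_affine (g g' : R -> R) (M k b : R) : measurable_fun setT g ->
  measurable_fun setT g' -> (forall x, `|g x| <= M) ->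
  {ae rho, forall t, g' t = k * g t + b} -> rmean rho g' = k * rmean rho g + b.
Proof.
move=> mg mg' gM gg'; rewrite /rmean.
have ig := @bounded_integrable _ rho _ _ mg gM.
have mkg : measurable_fun setT (fun x => k * g x) by exact: measurable_funM.
have ikg : rho.-integrable setT (EFin \o (fun x => k * g x)).
  apply: (@bounded_integrable _ _ _ (`|k| * M)) => // x.
  by rewrite normrM ler_wpM2l.
have ib : rho.-integrable setT (EFin \o (fun=> b)).
  by apply: (@bounded_integrable _ _ _ `|b|).
rewrite (ae_eq_Rintegral mg' _ gg'); last exact: measurable_funD.
rewrite RintegralD// RintegralZl// Rintegral_cst//.
by rewrite [X in fine X](probability_setT rho) mulr1.
Qed.

Lemma rstd_affine (g g' : R -> R) (M k b : R) : measurable_fun setT g ->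
  measurable_fun setT g' -> (forall x, `|g x| <= M) -> 0 <= k ->
  {ae rho, forall t, g' t = k * g t + b} -> rstd rho g' = k * rstd rho g.
Proof.
move=> mg mg' gM k0 gg'; rewrite /rstd (rmean_affine mg mg' gM gg').
set m := rmean rho g.
rewrite (@ae_eq_Rintegral _ _ _ (fun t => k ^+ 2 * (g t - m) ^+ 2)).
- rewrite RintegralZl//; last exact: deviation_integrable mg gM.
  by rewrite sqrtrM ?sqr_ge0// sqrtr_sqr ger0_norm.
- exact: deviation_measurable.
- by apply: measurable_funM => //; exact: deviation_measurable.
- by apply: filterS gg' => t ->; rewrite -exprMn; congr (_ ^+ 2); ring.
Qed.

End MeanAndDeviation.

(** Since [F] has reached [e] at [a] and is at most [1 - e] before [b], its quantiles are at most
    [a] at levels below [e] and at least [b] at levels from [1 - e] up to, but excluding, 1. As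
    [rho] has no atoms, these levels are attained on sets of known mass. *)
Lemma quantile_std_ge (R : realType) (rho : probability R R) (F : R -> R)
    (B : R) (a b e : R) : no_atoms rho ->
  (forall s, s < - B -> F s = 0) -> (forall s, B <= s -> F s = 1) ->
  (forall s, F s <= 1) -> 0 <= B ->
  0 < e < 1 -> e <= b - a -> e <= F a -> (forall s, s < b -> F s <= 1 - e) ->
  Num.sqrt ((e / 2) ^+ 2 * (e / 4)) <=
    rstd rho (fun t => ginv F (Defs.cdf rho t)).
Proof.
move=> rho0 Flo Fhi F1 B0 /andP[e0 e1] eab eFa eFb.
have [t1 t1E] : exists t, Defs.cdf rho t = e / 2.
  by apply: atomless_cdf_surj => //; apply/andP; split; lra.
have [t2 t2E] : exists t, Defs.cdf rho t = 1 - e / 2.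
  by apply: atomless_cdf_surj => //; apply/andP; split; lra.
(* The upper set stops at level [1 - e / 4], because at level 1 [ginv] takes its default value 0. It
   keeps the mass [e / 4]. *)
have [t3 t3E] : exists t, Defs.cdf rho t = 1 - e / 4.
  by apply: atomless_cdf_surj => //; apply/andP; split; lra.
have t23 : t2 <= t3.
  by rewrite leNgt; apply/negP => /ltW/(cdf_homo rho); rewrite t2E t3E; lra.
apply: (@rstd_ge _ _ _ B a b _ _ [set t | t <= t1] `]t2, t3]%classic) => //.
- exact: (quantile_measurable rho Flo Fhi F1 B0).
- exact: (quantile_norm_le rho Flo Fhi F1 B0).
- exact: measurable_le.
- by rewrite -cdfE t1E lee_fin; lra.
- by rewrite prob_itv_ocE// t2E t3E lee_fin; lra.
- by lra.
- by lra.
- move=> t /= /(cdf_homo rho); rewrite t1E => tt1.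
  by apply: (ginv_le Flo Fhi); rewrite ?cdf_ge0//=; lra.
- move=> t /=; rewrite in_itv/= => /andP[/ltW/(cdf_homo rho) + /(cdf_homo rho)].
  rewrite t2E t3E => h2 h3; apply: (ginv_ge Flo Fhi).
    by rewrite cdf_ge0/=; lra.
  by move=> s /eFb; lra.
Qed.

(** * Measures on the Euclidean space *)

Section EuclideanSpace.
Variables (R : realType) (d : nat).
Implicit Types x y a : 'rV[R]_d.

Lemma dotvC x y : dotv x y = dotv y x.
Proof. by apply: eq_bigr => i _; rewrite mulrC. Qed.

Lemma dotv_mul x y : dotv x y = (x *m y^T) ord0 ord0.
Proof. by rewrite mxE; apply: eq_bigr => i _; rewrite mxE. Qed.

Lemma dotvDl x y a : dotv (x + y) a = dotv x a + dotv y a.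
Proof. by rewrite !dotv_mul mulmxDl mxE. Qed.

Lemma dotvDr x y a : dotv a (x + y) = dotv a x + dotv a y.
Proof. by rewrite ![dotv a _]dotvC dotvDl. Qed.

Lemma dotvZr (k : R) x y : dotv x (k *: y) = k * dotv x y.
Proof. by rewrite !dotv_mul linearZ/= -scalemxAr mxE. Qed.

Lemma dotvNr x y : dotv x (- y) = - dotv x y.
Proof. by rewrite -scaleN1r dotvZr mulN1r. Qed.

Lemma dotv_mulmx x y (A : 'M[R]_d) : dotv (x *m A) y = dotv x (y *m A^T).
Proof. by rewrite !dotv_mul trmx_mul trmxK mulmxA. Qed.

Lemma dotv_ge0 x : 0 <= dotv x x.
Proof. by apply: sumr_ge0 => i _; rewrite -expr2 sqr_ge0. Qed.

Lemma dotv_eq0 x : (dotv x x == 0) = (x == 0).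
Proof.
apply/idP/eqP => [|->]; last first.
  by rewrite /dotv big1// => i _; rewrite mxE mul0r.
rewrite psumr_eq0 => [|i _]; last by rewrite -expr2 sqr_ge0.
move=> /allP h; apply/rowP => i; rewrite mxE; apply/eqP.
by have := h i (mem_index_enum _); rewrite -expr2 sqrf_eq0.
Qed.

Lemma coord_norm_le x i : `|x ord0 i| <= `|x|.
Proof.
rewrite [leRHS]/Num.norm/= mx_normrE.
exact: (@le_bigmax _ _ _ 0 (fun ij => `|x ij.1 ij.2|) (ord0, i)).
Qed.

(** Here [|x|] is the maximum norm of row vectors, hence the factor [d] where Cauchy-Schwarz would
    have 1. *)
Lemma dotv_norm_le x y : `|dotv x y| <= d%:R * `|x| * `|y|.
Proof.
rewrite (le_trans (ler_norm_sum _ _ _))//.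
rewrite (@le_trans _ _ (\sum_(i < d) `|x| * `|y|))//.
  by apply: ler_sum => i _; rewrite normrM ler_pM// coord_norm_le.
by rewrite sumr_const card_ord -mulrA mulr_natl.
Qed.

Lemma dotv_continuous a : continuous (fun x => dotv x a).
Proof.
rewrite (_ : (fun _ => _) = \sum_(i < d) (fun x : 'rV[R]_d => x ord0 i * a ord0 i)).
  apply: (big_ind (fun f : 'rV[R]_d -> R => continuous f)).
  - exact: cst_continuous.
  - by move=> f g fc gc x; exact: (continuousD (fc x) (gc x)).
  - by move=> i _ x; exact: (continuousM (@coord_continuous _ _ _ ord0 i x) (@cst_continuous _ _ (a ord0 i) x)).
by apply/funext => x; rewrite fct_sumE.
Qed.

Lemma sphere_norm_le1 x : dotv x x = 1 -> `|x| <= 1.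
Proof.
move=> x1; rewrite [leLHS]/Num.norm/= mx_normrE; apply: bigmax_le => // -[i j] _ /=.
rewrite (ord1 i) -(@expr_le1 _ 2)// real_normK ?num_real// -x1 expr2.
rewrite /dotv (bigD1 j)//= lerDl sumr_ge0// => k _.
by rewrite -expr2 sqr_ge0.
Qed.

Lemma dotv_sq_continuous : continuous (fun x => dotv x x).
Proof.
rewrite (_ : (fun _ => _) = \sum_(i < d) (fun x : 'rV[R]_d => x ord0 i * x ord0 i)).
  apply: (big_ind (fun f : 'rV[R]_d -> R => continuous f)).
  - exact: cst_continuous.
  - by move=> f g fc gc x; exact: (continuousD (fc x) (gc x)).
  - by move=> i _ x; exact: (continuousM (@coord_continuous _ _ _ ord0 i x) (@coord_continuous _ _ _ ord0 i x)).
by apply/funext => x; rewrite fct_sumE.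
Qed.

Lemma sphere_compact : compact [set x : 'rV[R]_d | dotv x x = 1].
Proof.
apply: bounded_closed_compact.
  exists 1; split; rewrite ?num_real// => M M1 x /= /sphere_norm_le1 /le_trans.
  by apply; exact: ltW.
apply: (@closed_comp _ _ (fun x => dotv x x) [set 1]) => // x _.
exact: dotv_sq_continuous.
Qed.

Lemma open_measurable_Rd (U : set 'rV[R]_d) : open U -> measurable (U : set (Rd R d)).
Proof. by move=> oU; exact: sub_sigma_algebra. Qed.

Lemma continuous_measurable_Rd (f : 'rV[R]_d -> R) : continuous f ->
  measurable_fun setT (f : Rd R d -> R).
Proof.
move=> cf; apply: (measurability (@RGenOInfty.G R)).
  exact: RGenOInfty.measurableE.
move=> _ [_ [x ->] <-]; rewrite setTI; apply: open_measurable_Rd.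
by apply: open_comp => // y _; exact: cf.
Qed.

Lemma continuous_measurable_RdRd (f : 'rV[R]_d -> 'rV[R]_d) : continuous f ->
  measurable_fun setT (f : Rd R d -> Rd R d).
Proof.
move=> cf; apply: (@measurability _ _ (Rd R d) (Rd R d) setT f (@open 'rV[R]_d) erefl).
move=> _ [U oU <-]; rewrite setTI; apply: open_measurable_Rd.
by apply: open_comp => // y _; exact: cf.
Qed.

Lemma mulmx_norm_le x (A : 'M[R]_d) : `|x *m A| <= d%:R * `|A| * `|x|.
Proof.
rewrite [leLHS]/Num.norm/= mx_normrE; apply: bigmax_le => [|[i j] _ /=].
  by rewrite !mulr_ge0.
rewrite (ord1 i) mxE (le_trans (ler_norm_sum _ _ _))//.
rewrite (@le_trans _ _ (\sum_(k < d) `|A| * `|x|))//.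
  apply: ler_sum => k _; rewrite normrM mulrC ler_pM// ?coord_norm_le//.
  rewrite [leRHS]/Num.norm/= mx_normrE.
  exact: (@le_bigmax _ _ _ 0 (fun ij => `|A ij.1 ij.2|) (k, j)).
by rewrite sumr_const card_ord -mulrA mulr_natl.
Qed.

Lemma affine_continuous (A : 'M[R]_d) (b : 'rV[R]_d) :
  continuous (fun x => x *m A + b).
Proof.
move=> x; apply: (iffRL (@cvgrPdist_lt _ _ _ (nbhs x) _ _ _)) => e e0.
have C0 : 0 < d%:R * `|A| + 1 :> R by rewrite ltr_wpDl ?mulr_ge0.
near=> y; rewrite opprD addrACA subrr addr0 -mulmxBl.
rewrite (le_lt_trans (mulmx_norm_le _ _))//.
rewrite (@le_lt_trans _ _ ((d%:R * `|A| + 1) * `|x - y|))//.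
  by rewrite ler_wpM2r// lerDl.
rewrite mulrC -ltr_pdivlMr//.
by near: y; apply: cvgr_dist_lt => //; rewrite divr_gt0.
Unshelve. all: by end_near. Qed.

Lemma measurable_dotv_le (th : 'rV[R]_d) (s : R) :
  measurable ([set x | dotv x th <= s] : set (Rd R d)).
Proof.
have := continuous_measurable_Rd (@dotv_continuous th).
by move=> /(_ measurableT _ (measurable_le s)); rewrite setTI.
Qed.

Lemma measurable_dotv_ge (th : 'rV[R]_d) (s : R) :
  measurable ([set x | s <= dotv x th] : set (Rd R d)).
Proof.
have := continuous_measurable_Rd (@dotv_continuous th).
move=> /(_ measurableT _ (measurable_itv `[s, +oo[)); rewrite setTI.
by rewrite set_itvcy.
Qed.

End EuclideanSpace.

(** * Supports and the spread of one-dimensional projections *)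

Section Support.
Variables (R : realType) (d : nat) (P : probability (Rd R d) R).

Lemma ae_imply (A C : Rd R d -> Prop) : (forall x, A x -> C x) ->
  {ae P, forall x, A x} -> {ae P, forall x, C x}.
Proof. by move=> AC; exact: filterS. Qed.

(* The near-covering form of compactness, taken along the almost-everywhere
   filter of [P] itself, replaces a finite subcover by null open sets. *)
Lemma ae_notin_compact (K : set 'rV[R]_d) : compact K ->
  K `&` msupp P = set0 -> {ae P, forall x, ~ K x}.
Proof.
move=> /compact_near_coveringP cK Ksupp.
suff h : {ae P, forall i, K `<=` (fun x => i <> x :> 'rV[R]_d)}.
  by apply: ae_imply h => i Ki Kii; exact: (Ki i).
apply: (cK (Rd R d) (almost_everywhere P) (fun i x => i <> x :> 'rV[R]_d)).
move=> x Kx.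
have /existsNP[U /not_implyP[oU /not_implyP[Ux /negP]]] : ~ msupp P x.
  by move=> sx; have : (K `&` msupp P) x by []; rewrite Ksupp.
rewrite -leNgt => PU.
exists (U, ~` U); last by move=> [y i] /= [Uy nUi] iy; apply: nUi; rewrite iy.
split => /=; first exact: open_nbhs_nbhs.
exists U; split; first exact: open_measurable_Rd.
  by apply/eqP; rewrite -measure_le0.
by move=> y /= /contrapT.
Qed.

(** The complement of a large ball is a countable union of compact shells [K n] that miss the
    support, and each of them is null. *)
Lemma ae_norm_le : compact (msupp P) ->
  exists2 B : R, 0 < B & {ae P, forall x, `|x : 'rV[R]_d| <= B}.
Proof.
move=> /compact_bounded[M [Mr MB]].
pose K (n : nat) := [set x : 'rV[R]_d | `|M| + 2 <= `|x| <= n%:R].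
have ncont := @norm_continuous R 'rV[R]_d.
have Kc n : compact (K n).
  apply: bounded_closed_compact.
    exists n%:R; split; rewrite ?num_real// => c nc x /= /andP[_ xn].
    exact: le_trans xn (ltW nc).
  rewrite (_ : K n = [set x | `|M| + 2 <= `|x|] `&` [set x | `|x| <= n%:R]).
    apply: closedI.
      apply: (@closed_comp _ _ (fun x : 'rV[R]_d => `|x|) [set y | `|M| + 2 <= y]);
        [by move=> x _; exact: ncont|exact: closed_ge].
    apply: (@closed_comp _ _ (fun x : 'rV[R]_d => `|x|) [set y | y <= n%:R]);
      [by move=> x _; exact: ncont|exact: closed_le].
  by apply/seteqP; split => x /= /andP.
have Ksupp n : K n `&` msupp P = set0.
  rewrite -subset0 => x [/= /andP[Mx _] sx].
  (* [MB] bounds the support by every radius strictly above [M]; the shells start one unit beyond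
     the radius chosen here. *)
  have := MB (`|M| + 1) _ x sx; rewrite ltr_pwDr ?ler_norm// => /(_ isT)/= h.
  by have := le_trans Mx h; rewrite lerD2l leNgt ltrDl ltr01.
exists (`|M| + 2); first by rewrite ltr_wpDl.
have := ae_foralln (fun n => ae_notin_compact (Kc n) (Ksupp n)).
apply: ae_imply => x hx; rewrite leNgt; apply/negP => Mx.
apply: (hx (Num.bound `|x : 'rV[R]_d|)); rewrite /K/= (ltW Mx)/=.
by apply/ltW/archi_boundP.
Qed.

Lemma ae_prob1 (A : set (Rd R d)) : measurable A -> {ae P, forall x, A x} ->
  P A = 1%E.
Proof.
move=> mA aeA; have := probability_setC P mA.
rewrite (_ : P (~` A) = 0%E); last first.
  by apply: measure_negligible => //; exact: measurableC.
have : P A \is a fin_num by exact: fin_num_measure.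
case: (P A) => // r _ /eqP; rewrite -EFinB eqe eq_sym subr_eq0 => /eqP <- //.
Qed.

Lemma ae_prob0 (A : set (Rd R d)) : measurable A -> {ae P, forall x, ~ A x} ->
  P A = 0%E.
Proof.
move=> mA [N [mN N0 AN]]; apply: measure_negligible => //.
by exists N; split => // x Ax; apply: AN => /=; apply.
Qed.

Lemma ae_prob_le (A C : set (Rd R d)) : measurable A -> measurable C ->
  {ae P, forall x, A x -> C x} -> (P A <= P C)%E.
Proof.
move=> mA mC AC.
have mAC : measurable (A `\` C) by exact: measurableD.
have AC0 : P (A `\` C) = 0%E.
  by apply: ae_prob0 => //; apply: ae_imply AC => x h [/h].
apply: (@le_trans _ _ (P (C `|` (A `\` C)))).
  rewrite le_measure ?inE//; first exact: measurableU.
  by move=> x Ax; have [Cx|nCx] := pselect (C x); [left|right].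
by apply: (le_trans (measureU2 _ _ _)) => //; rewrite [X in (_ + X)%E]AC0 adde0.
Qed.

(** Otherwise all support points have the same inner product with [th], and the support lies in a
    hyperplane with normal [th]. An empty support lies in any hyperplane. *)
Lemma spread_point (th : 'rV[R]_d) : th != 0 ->
  (~ exists (a : 'rV[R]_d) (c : R),
      a != 0 /\ msupp P `<=` [set x | dotv x a = c]) ->
  exists x y, [/\ msupp P x, msupp P y & dotv x th < dotv y th].
Proof.
move=> th0 nh; apply: contrapT => H; apply: nh.
have [[x0 sx0]|nex] := pselect (exists x, msupp P x); last first.
  by exists th, 0; split => // x sx; case: nex; exists x.
exists th, (dotv x0 th); split => // x sx /=; apply/eqP; rewrite eq_le.
by apply/andP; split; rewrite leNgt; apply/negP => h; apply: H;
  [exists x0, x|exists x, x0].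
Qed.

(** For a fixed direction, two support points with distinct projections yield open half-spaces of
    positive mass, and slightly tilted, slightly larger half-spaces keep that mass. Near-covering
    compactness of the sphere, with [e] tending to 0 from the right, makes one [e] serve all
    directions. *)
Lemma uniform_spread : Pcstar P -> exists2 e : R, 0 < e < 1 &
  forall th : 'rV[R]_d, dotv th th = 1 -> exists a b : R,
    [/\ e <= b - a, (e%:E <= P [set x | (dotv x th <= a)%R])%E
      & (e%:E <= P [set x | (b <= dotv x th)%R])%E].
Proof.
move=> [_ cs nh].
pose Q (e : R) (th : 'rV[R]_d) := exists a b : R,
    [/\ e <= b - a, (e%:E <= P [set x | (dotv x th <= a)%R])%E
      & (e%:E <= P [set x | (b <= dotv x th)%R])%E].
suff : \forall e \near 0^'+, [set th | dotv th th = 1] `<=` Q e.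
  move=> h; have : \forall e \near (0 : R)^'+, 0 < e < 1 /\
      [set th | dotv th th = 1] `<=` Q e.
    near=> e; split; last by near: e.
    by apply/andP; split; near: e; [exact: nbhs_right_gt|exact: nbhs_right_lt].
  by move=> /filter_ex[e [e01 eQ]]; exists e.
have [B B0 aeB] := ae_norm_le cs.
apply: (iffLR (compact_near_coveringP _) (@sphere_compact R d)) => th th1.
have th0 : th != 0 by rewrite -dotv_eq0 th1 oner_neq0.
have [x [y [sx sy xy]]] := spread_point th0 nh.
(* The gap is cut in fifths: each side gives up one [q] to its open half-space and one to the tilt
   of the direction, which leaves [b - a = q]. *)
pose q := (dotv y th - dotv x th) / 5.
have q0 : 0 < q by rewrite divr_gt0// subr_gt0.
pose U := [set z | dotv z th < dotv x th + q].
pose V := [set z | dotv y th - q < dotv z th].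
have oU : open U.
  by apply: (@open_comp _ _ (fun z => dotv z th) [set r | r < dotv x th + q]);
    [move=> z _; exact: dotv_continuous|exact: open_lt].
have oV : open V.
  by apply: (@open_comp _ _ (fun z => dotv z th) [set r | dotv y th - q < r]);
    [move=> z _; exact: dotv_continuous|exact: open_gt].
have PU : (0 < P U)%E by apply: sx => //; rewrite /U/= ltrDl.
have PV : (0 < P V)%E by apply: sy => //; rewrite /V/= ltrBlDr ltrDl.
have fP (A : set (Rd R d)) : measurable A -> (0 < P A)%E -> 0 < fine (P A).
  by move=> mA PA; rewrite -lte_fin fineK// fin_num_measure.
have mU := open_measurable_Rd oU; have mV := open_measurable_Rd oV.
have dB0 : 0 < d%:R * B + 1 by rewrite ltr_wpDl// mulr_ge0// ltW.
(* Required of [e]: at most [q], [P U] and [P V]. Required of [th']: within [q / (d * B + 1)] of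
   [th], the added 1 keeping the divisor positive. *)
near=> th' e => /=.
have closeth (z : 'rV[R]_d) : `|z| <= B -> `|dotv z th - dotv z th'| <= q.
  move=> zB; rewrite -dotvNr -dotvDr (le_trans (dotv_norm_le _ _))//.
  apply: (@le_trans _ _ ((d%:R * B + 1) * `|th - th'|)).
    by rewrite ler_wpM2r// (@le_trans _ _ (d%:R * B)) ?lerDl// ler_wpM2l.
  rewrite mulrC -ler_pdivlMr//; near: th'.
  by apply: cvgr_dist_le => //; rewrite divr_gt0.
exists (dotv x th + 2 * q), (dotv y th - 2 * q); split.
- rewrite (_ : _ - _ = q); last by rewrite /q; field.
  by near: e; exact: nbhs_right_le.
- apply: (@le_trans _ _ (P U)).
    rewrite -[leRHS]fineK ?fin_num_measure// lee_fin.
    by near: e; apply: nbhs_right_le; exact: fP.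
  apply: ae_prob_le => //; first exact: measurable_dotv_le.
  apply: ae_imply aeB => z /closeth; rewrite ler_norml => /andP[h1 h2].
  by rewrite /U/= => h3; lra.
- apply: (@le_trans _ _ (P V)).
    rewrite -[leRHS]fineK ?fin_num_measure// lee_fin.
    by near: e; apply: nbhs_right_le; exact: fP.
  apply: ae_prob_le => //; first exact: measurable_dotv_ge.
  apply: ae_imply aeB => z /closeth; rewrite ler_norml => /andP[h1 h2].
  by rewrite /V/= => h3; lra.
Unshelve. all: by end_near. Qed.

End Support.

(** * The normalized transform *)

Section NormalizedTransform.
Variables (R : realType) (d : nat) (rho : probability R R).
Hypothesis rho_atomless : no_atoms rho.

(** [B] does not depend on [th]: unit vectors have maximum norm at most 1, so every projection of
    the ball that carries [P] lies in one common interval. *)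
Lemma radon_cdf_bounds (P : probability (Rd R d) R) : compact (msupp P) ->
  exists2 B : R, 0 <= B & forall th : sphere R d,
    let F := Defs.cdf (radon P th) in
    [/\ forall s : R, s < - B -> F s = 0, forall s, B <= s -> F s = 1
      & forall s, F s <= 1].
Proof.
move=> /ae_norm_le[B B0 aeB].
have dth (th : sphere R d) (x : 'rV[R]_d) : `|x| <= B ->
    `|dotv x (val th)| <= d%:R * B.
  move=> xB; rewrite (le_trans (dotv_norm_le _ _))// -[leRHS]mulr1.
  rewrite ler_pM// ?mulr_ge0// ?ler_wpM2l//.
  by apply: sphere_norm_le1; apply/eqP; exact: valP th.
exists (d%:R * B) => [|th F]; first by rewrite mulr_ge0// ltW.
split=> s.
- move=> sB; rewrite /F /Defs.cdf /radon /pushforward ae_prob0//.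
    exact: measurable_dotv_le.
  apply: ae_imply aeB => x /(dth th); rewrite ler_norml => /andP[h _] /= xs.
  by have := lt_le_trans (le_lt_trans xs sB) h; rewrite ltxx.
- move=> sB; rewrite /F /Defs.cdf /radon /pushforward ae_prob1//.
    exact: measurable_dotv_le.
  by apply: ae_imply aeB => x /(dth th); rewrite ler_norml => /andP[_ h] /=; lra.
- rewrite -lee_fin fineK; first by apply: probability_le1; exact: measurable_dotv_le.
  by apply: fin_num_measure; exact: measurable_dotv_le.
Qed.

(** The quantifier order matters: one [B] and one [s0] for all directions, from the common interval
    of the projections and from the uniform spread. *)
Lemma cdt_radon_bounds (P : probability (Rd R d) R) : Pcstar P ->
  exists B s0 : R, 0 < s0 /\ forall th : sphere R d,
    [/\ measurable_fun setT (cdt rho (radon P th)),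
        forall t, `|cdt rho (radon P th) t| <= B
      & s0 <= rstd rho (cdt rho (radon P th))].
Proof.
move=> cP; have [_ cs _] := cP.
have [B B0 FB] := radon_cdf_bounds cs.
have [e e01 spread] := uniform_spread cP.
have /andP[e0 _] := e01.
exists B, (Num.sqrt ((e / 2) ^+ 2 * (e / 4))); split.
  by rewrite sqrtr_gt0 mulr_gt0// ?exprn_gt0// divr_gt0.
move=> th; have [Flo Fhi F1] := FB th.
have [a [b [eab ea eb]]] := spread _ (eqP (valP th)).
split.
- exact: (quantile_measurable rho Flo Fhi F1 B0).
- exact: (quantile_norm_le rho Flo Fhi F1 B0).
- apply: (@quantile_std_ge _ _ _ B a b) => //.
    rewrite -lee_fin fineK//.
    by apply: fin_num_measure; exact: measurable_dotv_le.
  move=> s sb; rewrite /Defs.cdf /radon /pushforward.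
  have mle := measurable_dotv_le (val th) s.
  have mge := measurable_dotv_ge (val th) b.
  (* For [s < b] the two half-spaces are disjoint. *)
  have : (P [set x | (dotv x (val th) <= s)%R] <= 1 - P [set x | (b <= dotv x (val th))%R])%E.
    rewrite -probability_setC// le_measure ?inE//; first exact: measurableC.
    by move=> x /= xs; apply/negP; rewrite -ltNge (le_lt_trans xs).
  rewrite -lee_fin => h; rewrite fineK; last exact: fin_num_measure.
  by rewrite (le_trans h)// EFinB leeB.
Qed.

Lemma NRCDT_bounded (P : probability (Rd R d) R) : Pcstar P ->
  exists M : R, forall t th, `|NRCDT rho P t th| <= M.
Proof.
move=> /cdt_radon_bounds[B [s0 [s00 H]]]; exists ((B + B) / s0) => t th.
have [mg gB gs] := H th; rewrite /NRCDT normrM normfV.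
rewrite [X in _ / X]ger0_norm ?sqrtr_ge0//.
have B0 : 0 <= B := le_trans (normr_ge0 _) (gB t).
rewrite ler_pM ?invr_ge0 ?sqrtr_ge0//.
  by rewrite (le_trans (ler_normB _ _))// lerD// rmean_norm_le.
by rewrite lef_pV2// posrE (lt_le_trans s00 gs).
Qed.

End NormalizedTransform.

(** * The action of invertible matrices on directions *)

Section Directions.
Variables (R : realType) (d : nat).
Implicit Types v : 'rV[R]_d.

(** The Euclidean length, as opposed to the maximum norm [|v|]. *)
Definition vnorm v : R := Num.sqrt (dotv v v).

Lemma vnorm_gt0 v : v != 0 -> 0 < vnorm v.
Proof. by move=> v0; rewrite sqrtr_gt0 lt_neqAle dotv_ge0 eq_sym dotv_eq0 v0. Qed.

Lemma vnormZ (k : R) v : 0 <= k -> vnorm (k *: v) = k * vnorm v.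
Proof.
move=> k0; rewrite /vnorm dotvZr dotvC dotvZr mulrA -expr2.
by rewrite sqrtrM ?sqr_ge0// sqrtr_sqr ger0_norm.
Qed.

Lemma direction_subproof v : v != 0 ->
  dotv ((vnorm v)^-1 *: v) ((vnorm v)^-1 *: v) == 1.
Proof.
move=> v0; have n0 := vnorm_gt0 v0.
rewrite dotvZr dotvC dotvZr -[dotv v v]sqr_sqrtr ?dotv_ge0// -/(vnorm v).
by apply/eqP; field; rewrite gt_eqF.
Qed.

Definition direction v (v0 : v != 0) : sphere R d :=
  exist _ ((vnorm v)^-1 *: v) (direction_subproof v0).

Lemma sphere_neq0 (th : sphere R d) : val th != 0.
Proof. by rewrite -dotv_eq0 (eqP (valP th)) oner_neq0. Qed.

Lemma sphere_vnorm (th : sphere R d) : vnorm (val th) = 1.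
Proof. by rewrite /vnorm (eqP (valP th)) sqrtr1. Qed.

Lemma mulmx_unit_neq0 (A : 'M[R]_d) v : A \in unitmx -> v != 0 -> v *m A != 0.
Proof.
by move=> uA; apply: contra_neq => vA; rewrite -[v](mulmxK uA) vA mul0mx.
Qed.

(** Applied below to [A^T], since the adjoint moves a linear map from the points to the
    direction. *)
Definition dir_action (A : 'M[R]_d) (uA : A \in unitmx) (th : sphere R d) :=
  direction (mulmx_unit_neq0 uA (sphere_neq0 th)).

(** The first normalization is a positive rescaling, which the second one undoes. *)
Lemma dir_actionK (A C : 'M[R]_d) (uA : A \in unitmx) (uC : C \in unitmx) :
  A *m C = 1%:M -> cancel (dir_action uA) (dir_action uC).
Proof.
move=> AC th; apply: val_inj => /=.
have n0 := vnorm_gt0 (mulmx_unit_neq0 uA (sphere_neq0 th)).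
rewrite -scalemxAl -mulmxA AC mulmx1 vnormZ ?invr_ge0 ?ltW//.
by rewrite sphere_vnorm mulr1 invrK scalerA divff ?scale1r// gt_eqF.
Qed.

Lemma dir_action_bij (A : 'M[R]_d) (uA : A \in unitmx) : bijective (dir_action uA).
Proof.
have uA' : invmx A \in unitmx by rewrite unitmx_inv.
exists (dir_action uA'); apply: dir_actionK; [exact: mulmxV|exact: mulVmx].
Qed.

End Directions.

(** * Affine images of a measure: support, projections and normalized transform *)

Section AffineOrbit.
Variables (R : realType) (d : nat) (A : 'M[R]_d) (b : 'rV[R]_d).
Hypothesis uA : A \in unitmx.
Variable P : probability (Rd R d) R.

Definition affine_map (x : Rd R d) : Rd R d := x *m A + b.

Lemma affine_map_measurable : measurable_fun setT affine_map.
Proof. exact: continuous_measurable_RdRd (@affine_continuous _ _ A b). Qed.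

Lemma pushforward_affine_probability :
  exists P' : probability (Rd R d) R,
    (P' : set (Rd R d) -> \bar R) = pushforward P affine_map.
Proof.
by exists (distribution P (mfun_Sub (mem_set affine_map_measurable))).
Qed.

(** The map is a homeomorphism, so neighbourhoods of a point and of its image correspond and have
    equal masses. *)
Lemma msupp_affine :
  msupp (pushforward P affine_map) = (affine_map : 'rV[R]_d -> 'rV[R]_d) @` msupp P.
Proof.
have mapK x : (x - b) *m invmx A *m A + b = x by rewrite mulmxKV// subrK.
have Kmap x : (x *m A + b - b) *m invmx A = x by rewrite addrK mulmxK.
apply/seteqP; split => [x sx|_ [x sx <-] U oU Ux].
  exists ((x - b) *m invmx A) => [U oU Ux|]; last exact: mapK.
  (* This set is the image of [U], written as a preimage under the inverse map, which shows that it
     is open. *)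
  have := sx [set z | U ((z - b) *m invmx A)]; rewrite /pushforward.
  rewrite (_ : affine_map @^-1` _ = U) => [h|]; last first.
    by apply/seteqP; split => z /=; rewrite /affine_map Kmap.
  apply: h => //.
  rewrite (_ : mkset _ = (fun z => z *m invmx A + - (b *m invmx A)) @^-1` U).
    by apply: open_comp => // z _; exact: affine_continuous.
  by apply/seteqP; split => z /=; rewrite mulmxBl.
apply: (sx ((affine_map : 'rV[R]_d -> 'rV[R]_d) @^-1` U)) => //.
by apply: open_comp => // z _; exact: affine_continuous.
Qed.

Lemma Pcstar_affine : Pcstar P -> Pcstar (pushforward P affine_map).
Proof.
move=> [_ cs nh]; split; first exact: pushforward_affine_probability.
  rewrite msupp_affine; apply: continuous_compact => //.
  exact/continuous_subspaceT/affine_continuous.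
rewrite msupp_affine => -[a [c [a0 sub]]]; apply: nh.
(* The hyperplane pulled back along the map: [dotv (x *m A + b) a = dotv x (a *m A^T) + dotv b
   a]. *)
exists (a *m A^T), (c - dotv b a); split.
  by rewrite mulmx_unit_neq0// unitmx_tr.
move=> x sx /=; have := sub (affine_map x) (imageP _ sx).
by rewrite /= /affine_map dotvDl dotv_mulmx => <-; rewrite addrK.
Qed.

Let uAT : A^T \in unitmx. Proof. by rewrite unitmx_tr. Qed.

Lemma radon_affine_cdf (th : sphere R d) :
  Defs.cdf (radon (pushforward P affine_map) th) =
  (fun s => Defs.cdf (radon P (dir_action uAT th))
              ((s - dotv b (val th)) / vnorm (val th *m A^T))).
Proof.
apply/funext => s; have n0 := vnorm_gt0 (mulmx_unit_neq0 uAT (sphere_neq0 th)).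
rewrite /Defs.cdf /radon /pushforward; congr (fine (P _)).
apply/seteqP; split => x /=;
  rewrite /affine_map dotvDl dotv_mulmx dotvZr ler_pdivlMr// mulrAC mulVf ?gt_eqF//
    mul1r lerBrDr//.
Qed.

Variable rho : probability R R.
Hypothesis rho_atomless : no_atoms rho.

(** The shift cancels against the mean and the factor [k] against the deviation. Where
    [cdf rho t = 1] both CDTs have the default value 0 and break the affine rule, hence the
    hypothesis on [t]; mean and deviation ignore that null set. *)
Lemma NRCDT_affine (t : R) : Pcstar P -> Defs.cdf rho t < 1 ->
  NRCDT rho (pushforward P affine_map) t = NRCDT rho P t \o dir_action uAT.
Proof.
move=> cP t1; apply/funext => th /=.
have n0 := vnorm_gt0 (mulmx_unit_neq0 uAT (sphere_neq0 th)).
set k := vnorm _ in n0; set ps := dir_action uAT th.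
have [P' P'E] := pushforward_affine_probability.
(* Membership of the image makes its own CDT measurable. *)
have cP' : Pcstar P' by rewrite P'E; exact: Pcstar_affine.
have [M' [s0' [_ /(_ th)]]] := cdt_radon_bounds rho_atomless cP'.
rewrite P'E => -[mg' _ _].
have [M [s0 [s00 /(_ ps)[mg gM gs]]]] := cdt_radon_bounds rho_atomless cP.
have [_ cs _] := cP.
have [B _ /(_ ps)[Flo Fhi _]] := radon_cdf_bounds cs.
have cdtE u : Defs.cdf rho u < 1 ->
    cdt rho (radon (pushforward P affine_map) th) u =
    k * cdt rho (radon P ps) u + dotv b (val th).
  by move=> u1; rewrite /cdt radon_affine_cdf (ginv_affine Flo Fhi)// cdf_ge0.
have aeE : {ae rho, forall u, cdt rho (radon (pushforward P affine_map) th) u =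
    k * cdt rho (radon P ps) u + dotv b (val th)}.
  by apply: filterS (atomless_ae_cdf_lt1 rho_atomless) => u /cdtE.
have meanE := rmean_affine mg mg' gM aeE.
have stdE := rstd_affine mg mg' gM (ltW n0) aeE.
have std0 := lt_le_trans s00 gs.
rewrite /NRCDT (cdtE t t1) meanE stdE.
move: (cdt rho (radon P ps) t) (rmean _ _) (rstd _ _) std0 => u v w w0.
by field; rewrite !gt_eqF.
Qed.

End AffineOrbit.

(** * The transform [Nh] along an affine orbit *)

Section AveragedTransform.
Variables (R : realType) (d : nat) (rho : probability R R).
Variable (h : (sphere R d -> R) -> R).
Hypothesis rho_atomless : no_atoms rho.
Hypothesis h_bnd : h_bounded h.
Hypothesis h_inv : h_invariant h.

Lemma Nh_bounded (m : set (Rd R d) -> \bar R) : Pcstar m ->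
  exists C, forall t, `|Nh rho h m t| <= C.
Proof.
move=> cm; have [[P Pm] _ _] := cm; rewrite -Pm in cm *.
have [M NM] := NRCDT_bounded rho_atomless cm.
by have [C hC] := h_bnd M; exists C => t; apply: hC => th; exact: NM.
Qed.

Lemma affine_orbit_Pcstar (m : set (Rd R d) -> \bar R) : Pcstar m ->
  affine_orbit m `<=` @Pcstar R d.
Proof.
move=> cm _ [A [y [uA ->]]]; have [[P Pm] _ _] := cm; rewrite -Pm in cm *.
exact: Pcstar_affine.
Qed.

Lemma Nh_affine_orbit (m m' : set (Rd R d) -> \bar R) (t : R) : Pcstar m ->
  affine_orbit m m' -> Defs.cdf rho t < 1 -> Nh rho h m' t = Nh rho h m t.
Proof.
move=> cm [A [y [uA ->]]] t1; have [[P Pm] _ _] := cm; rewrite -Pm in cm *.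
have [M NM] := NRCDT_bounded rho_atomless cm.
rewrite /Nh (NRCDT_affine y uA rho_atomless cm t1).
by apply: h_inv; [exists M|exact: dir_action_bij].
Qed.

Lemma Nh_affine_orbit_ae (m m' : set (Rd R d) -> \bar R) : Pcstar m ->
  affine_orbit m m' -> {ae rho, forall t, Nh rho h m' t = Nh rho h m t}.
Proof.
move=> cm mm'; apply: filterS (atomless_ae_cdf_lt1 rho_atomless) => t.
exact: Nh_affine_orbit.
Qed.

(* On the null set [F_rho = 1] the transform is independent of [t]: measurability
   survives although [Nh_affine_orbit] fails there. *)
Lemma Nh_affine_orbit_measurable (m m' : set (Rd R d) -> \bar R) : Pcstar m ->
  measurable_fun setT (Nh rho h m) -> affine_orbit m m' ->
  measurable_fun setT (Nh rho h m').
Proof.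
move=> cm mN mm'.
have [[t0 t0E]|no1] := pselect (exists t, Defs.cdf rho t = 1); last first.
  have -> : Nh rho h m' = Nh rho h m; last by [].
  apply/funext => t; apply: Nh_affine_orbit mm' _ => //.
  rewrite lt_neqAle cdf_le1 andbT.
  by apply/eqP => tE; apply: no1; exists t.
have -> : Nh rho h m' =
    fun t => if Defs.cdf rho t < 1 then Nh rho h m t else Nh rho h m' t0.
  apply/funext => t; case: ltP => t1; first exact: Nh_affine_orbit mm' t1.
  have tE : Defs.cdf rho t = 1 by apply/eqP; rewrite eq_le cdf_le1.
  by rewrite /Nh /NRCDT /cdt tE t0E.
move: (Nh rho h m' t0) (Nh rho h m) mN => c f mf.
apply: measurable_fun_ifT => //.
exact: measurable_fun_ltr (cdf_measurable rho) (measurable_cst _).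
Qed.

Lemma Nh_affine_orbit_Linf (m m' : set (Rd R d) -> \bar R) : Pcstar m ->
  measurable_fun setT (Nh rho h m) -> affine_orbit m m' -> Linf rho (Nh rho h m').
Proof.
move=> cm mN mm'; split; first exact: Nh_affine_orbit_measurable mm'.
have [C hC] := Nh_bounded (affine_orbit_Pcstar cm mm').
by exists C; apply: filterS (atomless_ae_cdf_lt1 rho_atomless) => t _.
Qed.

End AveragedTransform.

(** * Separation *)

Section Separation.
Variables (R : realType) (rho : probability R R).

Lemma Linf_integrable (f : R -> R) : Linf rho f ->
  rho.-integrable setT (EFin \o f).
Proof.
move=> [mf [M fM]]; apply/integrableP; split; first exact/measurable_EFinP.
apply: (@le_lt_trans _ _ (\int[rho]_x (`|M|)%:E)%E).
  apply: ae_ge0_le_integral => //.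
    by apply: measurableT_comp => //; exact/measurable_EFinP.
  by apply: filterS fM => x fx _; rewrite lee_fin (le_trans fx)// ler_norm.
rewrite integral_cst// -ge0_fin_numE ?mule_ge0//.
by rewrite fin_numM// fin_num_measure.
Qed.

(** A negative bound holds at no point, which would make the whole line a null set, against the
    total mass 1. *)
Lemma ae_norm_le_ge0 (f : R -> R) (M : R) :
  {ae rho, forall t, `|f t| <= M} -> 0 <= M.
Proof.
move=> fM; rewrite leNgt; apply/negP => M0.
have [N [mN N0 subN]] : {ae rho, forall t : R, False}.
  by apply: filterS fM => t ft; have := le_lt_trans (normr_ge0 (f t)) (le_lt_trans ft M0);
    rewrite ltxx.
have NT : N = setT by rewrite -subTset => t _; apply: subN.
by have := probability_setT rho; rewrite NT in N0; rewrite [LHS]N0 => /eqP;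
  rewrite eqe eq_sym oner_eq0.
Qed.

Lemma Rintegral_ae_norm_le (f : R -> R) (M : R) : measurable_fun setT f ->
  {ae rho, forall t, `|f t| <= M} -> `|(\int[rho]_x f x)%R| <= M.
Proof.
move=> mf fM; have M0 := ae_norm_le_ge0 fM.
(* Truncation turns the essential bound into a pointwise one and changes [f] on a null set only. *)
pose f' x := if `|f x| <= M then f x else 0.
have mf' : measurable_fun setT f'.
  apply: measurable_fun_ifT => //.
  by apply: measurable_fun_ler => //; exact: measurableT_comp.
rewrite (ae_eq_Rintegral mf mf'); last first.
  by apply: filterS fM => t ft; rewrite /f' ft.
apply: Rintegral_norm_le => // x; rewrite /f'.
by case: ifP => //; rewrite normr0.
Qed.

Lemma Linf_mul (f k : R -> R) : Linf rho f -> Linf rho k -> Linf rho (f \* k).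
Proof.
move=> [mf [M fM]] [mk [N kN]]; split; first exact: measurable_funM.
exists (M * N); apply: filterS2 fM kN => t ft kt.
by rewrite normrM ler_pM.
Qed.

Lemma Linf_sub (f k : R -> R) : Linf rho f -> Linf rho k -> Linf rho (f \- k).
Proof.
move=> [mf [M fM]] [mk [N kN]]; split; first exact: measurable_funB.
exists (M + N); apply: filterS2 fM kN => t ft kt.
by rewrite (le_trans (ler_normB _ _))// lerD.
Qed.

(** The continuity constant is an essential bound of [k]. *)
Lemma Rintegral_mul_functional (k : R -> R) : Linf rho k ->
  cont_lin_functional rho (fun f => (\int[rho]_x (f x * k x))%R).
Proof.
move=> kL; split=> [f g fL gL|a f fL|].
- rewrite -RintegralD//; try exact/Linf_integrable/Linf_mul.
  by apply: eq_Rintegral => x _ /=; rewrite mulrDl.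
- rewrite -RintegralZl//; last exact/Linf_integrable/Linf_mul.
  by apply: eq_Rintegral => x _ /=; rewrite mulrA.
- have [mk [K kK]] := kL; exists K => f M [mf _] fM.
  apply: Rintegral_ae_norm_le; first exact: measurable_funM.
  by apply: filterS2 fM kK => t ft kt; rewrite mulrC normrM ler_pM.
Qed.

(** A nonnegative function with zero integral vanishes almost everywhere; this is applied to the
    square of [k]. *)
Lemma Rintegral_sq_gt0 (k : R -> R) : Linf rho k ->
  ~ {ae rho, forall t, k t = 0} -> 0 < (\int[rho]_x (k x * k x))%R.
Proof.
move=> kL nk; have kkL := Linf_mul kL kL.
rewrite lt_neqAle Rintegral_ge0 ?andbT => [|x _]; last by rewrite -expr2 sqr_ge0.
apply/eqP => k0; apply: nk.
have ikk := Linf_integrable kkL.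
have := integrable_fin_num measurableT ikk.
move=> /fineK; rewrite [fine _](esym k0) => ik0.
have [/(_ _)h _] := ae_eq_integral_abs rho measurableT (measurable_int _ ikk).
apply: filterS (h _) => [t /(_ I)/= [/eqP]|].
  by rewrite mulf_eq0 orbb => /eqP.
apply/esym; rewrite [LHS]ik0; apply: eq_integral => x _ /=.
by rewrite ger0_norm// -expr2 sqr_ge0.
Qed.

(** Integration against [k = f0 - g0] is constant on each class, and its two values differ by the
    integral of the square of [k], which is positive. Their midpoint is the threshold. *)
Lemma ae_classes_separable (f0 g0 : R -> R) (S T : set (R -> R)) :
  Linf rho f0 -> Linf rho g0 -> ~ {ae rho, forall t, f0 t = g0 t} ->
  (forall f, S f -> measurable_fun setT f /\ {ae rho, forall t, f t = f0 t}) ->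
  (forall g, T g -> measurable_fun setT g /\ {ae rho, forall t, g t = g0 t}) ->
  lin_separable rho S T.
Proof.
move=> fL gL fg HS HT; pose k := f0 \- g0.
have kL : Linf rho k := Linf_sub fL gL.
pose l (f : R -> R) := (\int[rho]_x (f x * k x))%R.
have lae f f1 : Linf rho f1 -> measurable_fun setT f ->
    {ae rho, forall t, f t = f1 t} -> l f = l f1.
  move=> [mf1 _] mf ff1; apply: ae_eq_Rintegral.
  - by apply: measurable_funM => //; case: kL.
  - by apply: measurable_funM => //; case: kL.
  - by apply: filterS ff1 => t ->.
have lfg : l g0 < l f0.
  rewrite -subr_gt0 /l -RintegralB//; try exact/Linf_integrable/Linf_mul.
  rewrite (_ : (\int[rho]_x _)%R = (\int[rho]_x (k x * k x))%R); last first.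
    by apply: eq_Rintegral => x _; rewrite -mulrBl.
  apply: Rintegral_sq_gt0 => // k0; apply: fg.
  by apply: filterS k0 => t /eqP; rewrite subr_eq0 => /eqP.
exists l, ((l f0 + l g0) / 2); split; first exact: Rintegral_mul_functional.
split=> [f /HS[mf ff0]|g /HT[mg gg0]].
  by rewrite (lae f f0)//; lra.
by rewrite (lae g g0)//; lra.
Qed.

End Separation.

Unset Implicit Arguments.

(** The two transforms are taken to differ as elements of the space of essentially bounded
    functions, so not almost everywhere equal. Their measurability is assumed because boundedness
    and invariance of [h] do not provide it; the other members of each orbit inherit it. *)
Theorem theorem16 (R : realType) (d : nat) (rho : probability R R)
  (h : (sphere R d -> R) -> R) (mu0 nu0 : set (Rd R d) -> \bar R) :
  (2 <= d)%N ->
  no_atoms rho ->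
  h_bounded h ->
  h_invariant h ->
  Pcstar mu0 -> Pcstar nu0 ->
  measurable_fun setT (Nh rho h mu0) ->
  measurable_fun setT (Nh rho h nu0) ->
  ~ {ae rho, forall t, Nh rho h mu0 t = Nh rho h nu0 t} ->
  [/\ affine_orbit mu0 `<=` @Pcstar R d,
      affine_orbit nu0 `<=` @Pcstar R d,
      (forall m, affine_orbit mu0 m -> Linf rho (Nh rho h m)),
      (forall m, affine_orbit nu0 m -> Linf rho (Nh rho h m))
    & lin_separable rho (Nh rho h @` affine_orbit mu0)
                        (Nh rho h @` affine_orbit nu0)].
Proof.
move=> _ rho0 hb hi cmu cnu mmu mnu neq.
have LN m : Pcstar m -> measurable_fun setT (Nh rho h m) -> Linf rho (Nh rho h m).
  move=> cm mN; split => //; have [C hC] := Nh_bounded rho0 hb cm.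
  by exists C; apply: filterS (atomless_ae_cdf_lt1 rho0) => t _.
split.
- exact: affine_orbit_Pcstar.
- exact: affine_orbit_Pcstar.
- by move=> m; exact: Nh_affine_orbit_Linf.
- by move=> m; exact: Nh_affine_orbit_Linf.
- apply: (ae_classes_separable (LN _ cmu mmu) (LN _ cnu mnu) neq).
    move=> _ [m om <-]; split; first exact: Nh_affine_orbit_measurable om.
    exact: Nh_affine_orbit_ae om.
  move=> _ [m om <-]; split; first exact: Nh_affine_orbit_measurable om.
  exact: Nh_affine_orbit_ae om.
Qed.
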